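(* Let $\pi:\omega\to\omega$ be a function with $\pi(n)\leq 2^n$ for every $n$. If $\sum_{n=0}^{\infty}\frac{\pi(n)}{2^n}=\infty$, then there is a sequence $\vec{\mathcal{A}}=\langle\mathcal{A}_n\mid n<\omega\rangle$ with $\mathcal{A}_n\subseteq P(n)$ and $|\mathcal{A}_n|=\pi(n)$ for every $n$, such that $\mathbb{P}_0(\mathrm{G}(\vec{\mathcal{A}}))=1$.
   Context: Each $n<\omega$ is identified with $\{0,\dots,n-1\}$, and $P(\omega)$ is identified with $2^\omega$ via indicator functions. $\mathbb{P}_0$ is the standard Borel probability measure on $2^\omega$, determined by $\mathbb{P}_0(C_t)=2^{-|t|}$ for $t\in 2^{<\omega}$, where $C_t$ is the set of $f\in 2^\omega$ extending $t$ (the fair coin-flipping measure). For a sequence $\vec{\mathcal{A}}=\langle\mathcal{A}_n\mid n<\omega\rangle$ with $\mathcal{A}_n\subseteq P(n)$, the set of guessed reals is $\mathrm{G}(\vec{\mathcal{A}})=\{X\in P(\omega)\mid X\cap n\in\mathcal{A}_n\text{ for infinitely many }n\}$. *)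

(* Defs.v *)
From mathcomp Require Import all_boot all_order all_algebra.
From mathcomp Require Import all_classical all_reals all_analysis.
From mathcomp Require Import zify lra.

Set Implicit Arguments.
Unset Strict Implicit.
Unset Printing Implicit Defensive.

Import Order.TTheory GRing.Theory Num.Theory.
Import numFieldTopology.Exports.

Local Open Scope classical_set_scope.
Local Open Scope ring_scope.

(* A subset X of omega is identified with its indicator function, a point of
   cantor_space. *)
Notation cantor_borel := (g_sigma_algebraType (@open cantor_space)).

Definition cylinder (t : seq bool) : set cantor_borel :=
  [set f | forall i, (i < size t)%N -> f i = nth false t i].

Lemma cylinder_mkseq (f g : cantor_space) n :
  cylinder (mkseq f n) g <-> forall i, (i < n)%N -> g i = f i.
Proof.
split=> gf i; last by rewrite size_mkseq => ni; rewrite nth_mkseq ?gf.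
by move=> ni; rewrite gf ?size_mkseq// nth_mkseq.
Qed.

Lemma open_cylinder_sub (U : set cantor_space) : open U ->
  forall f, U f -> exists n, cylinder (mkseq f n) `<=` U.
Proof.
move=> oU f Uf; apply: contrapT => /forallNP noN.
have /choice[g gP] : forall n, exists g : cantor_space,
    cylinder (mkseq f n) g /\ ~ U g.
  move=> n; have := noN n; rewrite -existsNE => -[h]/=.
  by move=> /not_implyP[? ?]; exists h.
have gf : g @ \oo --> f.
  apply/cvg_sup => N V [W] [[Z] oZ <-] ZfN ZV.
  apply: (filterS ZV); rewrite nbhs_simpl; exists N.+1 => // i /= Ni.
  have [/cylinder_mkseq gi _] := gP i.
  by rewrite /preimage/= gi.
have /gf[N _ NU] : nbhs f U by exact: open_nbhs_nbhs.
by have [_] := gP N; apply; apply: NU => /=.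
Qed.

Lemma measurable_coord i b : measurable [set f : cantor_borel | f i = b].
Proof.
apply: sub_sigma_algebra.
pose K := fun _ : nat => bool : topologicalType.
have /continuousP h : continuous (@proj nat K i : prod_topology K -> K i).
  exact: proj_continuous.
by apply: (h [set b]); exact: discrete_open.
Qed.

Lemma measurable_cylinder t : measurable (cylinder t).
Proof.
rewrite (_ : cylinder t =
  \bigcap_(i in `I_(size t)) [set f : cantor_borel | f i = nth false t i]) //.
by apply: bigcap_measurableType => i _; exact: measurable_coord.
Qed.

Lemma bigcup_cylinder (U : set cantor_borel) :
  (forall f, U f -> exists n, cylinder (mkseq f n) `<=` U) ->
  U = \bigcup_(t : seq bool)
        (if pselect (cylinder t `<=` U) then cylinder t else set0).
Proof.
move=> UP; apply/seteqP; split => [f Uf|f [t _]]; last first.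
  by case: pselect => [tU /tU//|?].
have [n nU] := UP _ Uf; exists (mkseq f n) => //.
case: pselect => //= ?; exact/cylinder_mkseq.
Qed.

Lemma measurable_cylinder_sub (U : set cantor_borel) :
  (forall f, U f -> exists n, cylinder (mkseq f n) `<=` U) -> measurable U.
Proof.
move=> /bigcup_cylinder ->; apply: countable_bigcupT_measurable => // t.
case: pselect => //= ?; exact: measurable_cylinder.
Qed.

Lemma measurable_cantorE :
  @measurable _ cantor_borel = <<s range cylinder >>.
Proof.
apply/seteqP; split; last first.
  apply: smallest_sub; first exact: sigma_algebra_measurable.
  by move=> _ [t _ <-]; exact: measurable_cylinder.
apply: smallest_sub; first exact: smallest_sigma_algebra.
move=> U /open_cylinder_sub/bigcup_cylinder ->.
apply: (@countable_bigcupT_measurable _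
  (g_sigma_algebraType (range cylinder))) => // t.
case: pselect => //= ?.
by apply: sub_sigma_algebra; exists t.
Qed.

(* Existence of the coin-flipping measure: the law of the binary digits of a
   uniform random real in [0, 1]. *)
Section digits.
Variable R : realType.

Definition digits (x : measurableTypeR R) : cantor_borel :=
  fun k => odd (Num.truncn (x * 2 ^+ k.+1)).

Lemma digits_coord k b : measurable [set x : measurableTypeR R | digits x k = b].
Proof.
have mt : measurable [set x : measurableTypeR R | digits x k = true].
  rewrite (_ : [set _ | _] = \bigcup_(m in [set m | odd m])
      `[m%:R / 2 ^+ k.+1, m.+1%:R / 2 ^+ k.+1[%classic).
    by apply: bigcup_measurable => m _; exact: measurable_itv.
  apply/seteqP; split => [x /= dx|x [m /= om]].
    have x0 : 0 <= x * 2 ^+ k.+1.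
      rewrite leNgt; apply/negP => x0; move: dx; rewrite /digits.
      by have /truncn0Pn -> : ~~ (1 <= x * 2 ^+ k.+1) by rewrite -ltNge; lra.
    exists (Num.truncn (x * 2 ^+ k.+1)) => //=.
    by rewrite in_itv/= ler_pdivrMr ?ltr_pdivlMr ?exprn_gt0//; exact: truncn_itv.
  rewrite in_itv/= ler_pdivrMr ?ltr_pdivlMr ?exprn_gt0// => xm.
  by rewrite /digits (truncn_def xm).
case: b => //; rewrite (_ : [set _ | _] = ~` [set x | digits x k = true]).
  exact: measurableC.
by apply/seteqP; split => x /=; case: (digits x k).
Qed.

Lemma measurable_digits :
  measurable_fun [set: measurableTypeR R] digits.
Proof.
apply: (measurability (range cylinder)); first exact: measurable_cantorE.
move=> _ [_ [t _ <-] <-]; rewrite setTI.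
rewrite (_ : _ @^-1` _ =
  \bigcap_(i in `I_(size t)) [set x : measurableTypeR R | digits x i = nth false t i]) //.
by apply: bigcap_measurableType => i _; exact: digits_coord.
Qed.

Fixpoint binval (t : seq bool) (v : nat) : nat :=
  if t is b :: t' then binval t' (b + v.*2) else v.

Lemma binval_rcons t b v : binval (rcons t b) v = (b + (binval t v).*2)%N.
Proof. by elim: t v => //=. Qed.

Lemma binval_lt t : (binval t 0 < 2 ^ size t)%N.
Proof.
elim/last_ind: t => // t b ih; rewrite binval_rcons size_rcons expnS.
by case: b; lia.
Qed.

Lemma truncn2 (y : R) : 0 <= y ->
  Num.truncn (2 * y) = (odd (Num.truncn (2 * y)) + (Num.truncn y).*2)%N.
Proof.
move=> y0; have y20 : 0 <= 2 * y by lra.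
set m := Num.truncn (2 * y).
have /andP[my ym] : m%:R <= 2 * y < m.+1%:R by exact: truncn_itv.
suff -> : Num.truncn y = m./2 by rewrite odd_double_half.
apply: truncn_def.
have mE : m%:R = (odd m)%:R + 2 * m./2%:R :> R.
  by rewrite -{1}(odd_double_half m) natrD -mul2n natrM.
move: my ym; rewrite -!natr1 mE.
by case: (odd m) => /=; lra.
Qed.

Lemma digits_cylinder t (x : R) : 0 <= x < 1 ->
  cylinder t (digits x) <-> Num.truncn (x * 2 ^+ size t) = binval t 0.
Proof.
move=> /andP[x0 x1]; elim/last_ind: t => [|t b ih].
  by split => // _; apply: truncn_def; rewrite expr0 mulr1 x0.
have -> : cylinder (rcons t b) (digits x) <->
          cylinder t (digits x) /\ digits x (size t) = b.
  split => [h|[h hb] i].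
    split => [i it|]; last by rewrite h ?size_rcons// nth_rcons ltnn eqxx.
    by rewrite h ?size_rcons ?ltnS ?(ltnW it)// nth_rcons it.
  rewrite size_rcons ltnS leq_eqVlt nth_rcons => /orP[/eqP->|it].
    by rewrite ltnn eqxx.
  by rewrite it; exact: h.
rewrite ih size_rcons binval_rcons /digits.
have -> : x * 2 ^+ (size t).+1 = 2 * (x * 2 ^+ size t).
  by rewrite exprS mulrCA.
have y0 : 0 <= x * 2 ^+ size t by rewrite mulr_ge0 ?exprn_ge0.
have := truncn2 y0.
move: (Num.truncn (2 * (x * _))) (Num.truncn (x * _)) => p q.
by move=> pq; split => [[<- <-]//|]; case: b => /=; lia.
Qed.

Lemma uniform_digits t :
  uniform_prob (@ltr01 R) (digits @^-1` cylinder t) = (2 ^- size t)%:E.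
Proof.
have mt : measurable (digits @^-1` cylinder t).
  by rewrite -[X in measurable X]setTI; apply: measurable_digits => //;
    exact: measurable_cylinder.
rewrite /uniform_prob integral_uniform_pdf.
rewrite (eq_integral (fun=> 1%E)); last first.
  move=> x; rewrite inE => -[_ /=]; rewrite in_itv/= /uniform_pdf => ->.
  by rewrite subr0 invr1.
rewrite integral_cst/= ?mul1e; last exact: measurableI.
set n := size t; set v := binval t 0.
have vn : v.+1%:R <= 2 ^+ n :> R by rewrite -natrX ler_nat binval_lt.
have n0 : 0 < 2 ^+ n :> R by rewrite exprn_gt0.
rewrite (_ : _ `&` _ = `[v%:R / 2 ^+ n, v.+1%:R / 2 ^+ n[%classic `|`
    ((digits @^-1` cylinder t) `&` [set 1])).
  rewrite measureU0//=; last 2 first.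
  - exact: measurableI.
  - apply: (subset_measure0 (mu := lebesgue_measure) (B := [set 1])) => //.
    + exact: measurableI.
    + exact: lebesgue_measure_set1.
  rewrite lebesgue_measure_itv/= lte_fin ltr_pM2r ?invr_gt0// ltr_nat ltnSn -EFinB.
  by rewrite -mulrBl -natr1 addrAC subrr add0r mul1r.
have vx (x : R) : v%:R / 2 ^+ n <= x < v.+1%:R / 2 ^+ n -> 0 <= x < 1.
  move=> /andP[vx xv]; apply/andP; split.
    by apply: le_trans vx; rewrite divr_ge0 // ltW.
  by apply: (lt_le_trans xv); rewrite ler_pdivrMr// mul1r.
apply/seteqP; split => x /=.
  rewrite in_itv/= => -[tx /andP[x0]]; rewrite le_eqVlt => /orP[/eqP x1|x1].
    by right; split.
  left; rewrite in_itv/= ler_pdivrMr ?ltr_pdivlMr//.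
  have <- : Num.truncn (x * 2 ^+ n) = v.
    by apply/digits_cylinder => //; rewrite x0.
  by apply: truncn_itv; rewrite mulr_ge0 // ltW.
rewrite !in_itv/= => -[xv|[tx x1]]; last first.
  by split => //; rewrite x1 lexx ler01.
have x01 := vx _ xv; split; last by case/andP: x01 => -> /ltW ->.
apply/digits_cylinder => //; apply: truncn_def.
by move: xv; rewrite ler_pdivrMr ?ltr_pdivlMr.
Qed.

End digits.

Lemma fair_coin_exists (R : realType) :
  exists P : probability cantor_borel R,
    forall t, P (cylinder t) = (2 ^- size t)%:E.
Proof.
exists (distribution (uniform_prob (@ltr01 R))
  (mfun_Sub (mem_set (@measurable_digits R)))) => t.
exact: uniform_digits.
Qed.

(* Pinned down on Borel sets by its values on cylinders: see
   fair_coin_cylinder and fair_coin_unique. *)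
Definition fair_coin (R : realType) : probability cantor_borel R :=
  projT1 (cid (fair_coin_exists R)).

Lemma fair_coin_cylinder (R : realType) (t : seq bool) :
  fair_coin R (cylinder t) = (2 ^- size t)%:E.
Proof. exact: (projT2 (cid (fair_coin_exists R))). Qed.

Lemma fair_coin_unique (R : realType) (P : probability cantor_borel R) :
  (forall t, P (cylinder t) = (2 ^- size t)%:E) ->
  forall B, measurable B -> P B = fair_coin R B.
Proof.
move=> Pt B mB; have Poo : (P (cylinder [::]) < +oo)%E by rewrite Pt ltry.
apply: (measure_unique (range cylinder `|` [set set0]) (fun=> cylinder [::]))
  => //.
- rewrite measurable_cantorE; apply/seteqP; split; apply: smallest_sub;
    try exact: smallest_sigma_algebra.
    by move=> C Ct; apply: sub_sigma_algebra; left.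
  move=> C [Ct|->]; first exact: sub_sigma_algebra.
  exact: sigma_algebra0.
- move=> C D [[t _ <-]|->]; last by move=> _; right; rewrite set0I.
  move=> [[u _ <-]|->]; last by right; rewrite setI0.
  wlog tu : t u / (size t <= size u)%N.
    by move=> h; have /orP[/h//|/h] := leq_total (size t) (size u); rewrite setIC.
  have [[f [ft fu]]|/forallNP nf] :=
      pselect (exists f, (cylinder t `&` cylinder u) f).
    left; exists u => //; apply/seteqP; split => [g gu|g []//]; split => // i it.
    by rewrite gu ?(leq_trans it)// -fu ?(leq_trans it)// ft.
  by right; apply/seteqP; split => // f /nf.
- by move=> _; left; exists [::].
- by apply/seteqP; split => // f _; exists 0%N => // i.
- move=> C [[t _ <-]|->]; last by rewrite !measure0.
  by exact: etrans (Pt t) (esym (fair_coin_cylinder R t)).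
Qed.

(* X :&: n, where n = {0, ..., n - 1}. *)
Definition trace (X : cantor_space) (n : nat) : {set 'I_n} :=
  [set i : 'I_n | X i].

Definition guessed_reals (A : forall n, {set {set 'I_n}}) : set cantor_borel :=
  [set X | infinite_set [set n | trace X n \in A n]].

Lemma measurable_guessed_reals A : measurable (guessed_reals A).
Proof.
rewrite (_ : guessed_reals A =
    lim_sup_set (fun n => [set X : cantor_borel | trace X n \in A n])).
  apply: bigcap_measurableType => m _; apply: bigcup_measurable => n _.
  apply: measurable_cylinder_sub => f /= fn.
  exists n => g /cylinder_mkseq gf /=; rewrite (_ : trace g n = trace f n)//.
  by apply/setP => i; rewrite !inE gf.
apply/seteqP; split => X /=.
  move=> infX m _; apply: contrapT => noX; apply: infX.
  apply: (@sub_finite_set _ _ `I_m); last exact: finite_II.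
  move=> n /= nA; rewrite ltnNge; apply/negP => mn; apply: noX.
  by exists n.
move=> supX /finite_seqP[s sE].
have [n /= sn nA] := supX (\max_(i <- s) i).+1 I.
have ns : [set` s] n by rewrite -sE.
by move: sn; rewrite ltnNge leq_bigmax_seq.
Qed.

(* Main.v *)
Require Import Defs.
From mathcomp Require Import all_boot all_order all_algebra.
From mathcomp Require Import all_classical all_reals all_analysis.
From mathcomp Require Import zify lra.

(** Read the first [n] bits of [X] as the dyadic interval of length [2 ^- n]
    that they determine, on a circle of circumference 1.  A family of [pi n]
    strings of length [n] can then be an arc of length [pi n / 2 ^ n], and the
    arcs can be laid end to end: the [n]-th one starts where the previous ones
    stop, at a multiple of [2 ^- n], so it is exactly a union of dyadic
    intervals of length [2 ^- n].  As the lengths have an infinite sum, the arcs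
    wind around the circle infinitely often.  Every [X], and not only almost
    every one, is therefore guessed infinitely often.

    The proof follows the distance from the starting point of the [n]-th arc to
    the interval of [X], counted in units of [2 ^- n]: this is [arc_rank].  For
    each [n] it numbers the strings of length [n] bijectively by the integers
    below [2 ^ n] ([arc_rank_inj], [arc_rank_lt]), so the strings of rank below
    [pi n] are [pi n] in number ([card_arc_family]).  The right end of the
    interval of [X] approaches the start of the current arc at least as fast as
    the arcs progress, except that it gains one full turn each time the arc
    passes over [X]; hence the total length of the first [n] arcs is at most one
    more than the number of times [X] was guessed ([arc_length_le_hits]). *)

Import Order.TTheory GRing.Theory Num.Theory.
Import numFieldTopology.Exports.

Local Open Scope classical_set_scope.
Local Open Scope ring_scope.

(** Passing from level [n] to level [n.+1] moves the starting point forward by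
    [pi n] units, which is a subtraction modulo [2 ^ n], and then halves the
    unit, which appends the bit [X n]. *)
Fixpoint arc_rank (pi : nat -> nat) (X : nat -> bool) (n : nat) : nat :=
  if n is m.+1 then
    let d := arc_rank pi X m in
    (X m + (if pi m <= d then d - pi m else d + 2 ^ m - pi m).*2)%N
  else 0%N.

Lemma arc_rank_lt (pi : nat -> nat) (X : nat -> bool) n :
  (forall n, (pi n <= 2 ^ n)%N) -> (arc_rank pi X n < 2 ^ n)%N.
Proof.
move=> pi_le; elim: n => [|n ih] //=.
by have := pi_le n; rewrite expnS; case: ifP; case: (X n); lia.
Qed.

Lemma eq_arc_rank (pi : nat -> nat) (X Y : nat -> bool) n :
  (forall i, (i < n)%N -> X i = Y i) -> arc_rank pi X n = arc_rank pi Y n.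
Proof.
elim: n => //= n ih XY; rewrite ih ?XY// => i ni.
by apply: XY; rewrite ltnS ltnW.
Qed.

(** The last bit is the parity of the rank, and the subtraction of [pi n] modulo
    [2 ^ n] can be undone because ranks at level [n] are below [2 ^ n]. *)
Lemma arc_rank_inj (pi : nat -> nat) (X Y : nat -> bool) n :
  (forall n, (pi n <= 2 ^ n)%N) ->
  arc_rank pi X n = arc_rank pi Y n -> forall i, (i < n)%N -> X i = Y i.
Proof.
move=> pi_le; elim: n => //= n ih XY i.
have [Xn dXY] : X n = Y n /\ arc_rank pi X n = arc_rank pi Y n.
  have := pi_le n; have := arc_rank_lt pi X n pi_le.
  have := arc_rank_lt pi Y n pi_le; move: XY.
  by do 2 case: ifP; case: (X n); case: (Y n) => /=; split => //; lia.
by rewrite ltnS leq_eqVlt => /orP[/eqP->//|]; exact: ih.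
Qed.

Definition indicator n (t : {set 'I_n}) (i : nat) : bool :=
  if insub i is Some j then j \in t else false.

Lemma indicatorE n (t : {set 'I_n}) (i : 'I_n) : indicator n t i = (i \in t).
Proof. by rewrite /indicator valK. Qed.

Lemma indicator_trace (X : cantor_space) n i :
  (i < n)%N -> indicator n (trace X n) i = X i.
Proof.
by move=> ni; rewrite (indicatorE n _ (Ordinal ni)) inE.
Qed.

Definition arc_family (pi : nat -> nat) n : {set {set 'I_n}} :=
  [set t | (arc_rank pi (indicator n t) n < pi n)%N].

Lemma mem_arc_family (pi : nat -> nat) (X : cantor_space) n :
  (trace X n \in arc_family pi n) = (arc_rank pi X n < pi n)%N.
Proof. by rewrite inE (eq_arc_rank _ _ _ _ (indicator_trace X n)). Qed.

Lemma card_ord_lt (m p : nat) : (p <= m)%N -> #|[set k : 'I_m | (k < p)%N]%SET| = p.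
Proof.
move=> pm; rewrite -sum1_card (eq_bigl (fun k : 'I_m => (k < p)%N)); last first.
  by move=> k; rewrite inE.
by rewrite -(big_ord_widen m (fun=> 1%N) pm) sum1_card card_ord.
Qed.

(** An injection between the [2 ^ n] subsets of [n] and the [2 ^ n] ranks is a
    bijection, so each rank below [pi n] is attained exactly once. *)
Lemma card_arc_family (pi : nat -> nat) n :
  (forall n, (pi n <= 2 ^ n)%N) -> #|arc_family pi n| = pi n.
Proof.
move=> pi_le.
pose rank (t : {set 'I_n}) := Ordinal (arc_rank_lt pi (indicator n t) n pi_le).
have rank_inj : injective rank.
  move=> t u /(congr1 val)/= /(arc_rank_inj _ _ _ _ pi_le) tu.
  by apply/setP => i; rewrite -!indicatorE tu.
have rank_bij : bijective rank.
  apply: (inj_card_bij rank_inj).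
  by rewrite card_ord -cardsT -powersetT card_powerset cardsT card_ord.
rewrite (_ : arc_family pi n = rank @^-1: [set k : 'I_(2 ^ n) | (k < pi n)%N]%SET).
  rewrite on_card_preimset ?card_ord_lt//.
  exact: onW_bij.
by apply/setP => t; rewrite !inE.
Qed.

(** The extra term makes the induction work: it is the distance from the start
    of the [n]-th arc to the right end of the interval of [X].  The right end is
    used because it can only move backwards as bits of [X] are revealed. *)
Lemma arc_length_le_hits (R : realFieldType) (pi : nat -> nat)
    (X : nat -> bool) n :
  (forall n, (pi n <= 2 ^ n)%N) ->
  \sum_(0 <= k < n) ((pi k)%:R / 2 ^+ k : R)
    + (arc_rank pi X n).+1%:R / 2 ^+ n
  <= 1 + (\sum_(0 <= k < n) (arc_rank pi X k < pi k))%:R.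
Proof.
move=> pi_le; elim: n => [|n ih]; first by rewrite !big_nil/= add0r addr0 expr0 divr1.
rewrite !big_nat_recr//= natrD.
set d := arc_rank pi X n in ih *.
have n0 : 0 < 2 ^+ n :> R by rewrite exprn_gt0.
set r := (if (pi n <= d)%N then d - pi n else d + 2 ^ n - pi n)%N.
suff step : (pi n)%:R / 2 ^+ n + (X n + r.*2).+1%:R / 2 ^+ n.+1
    <= d.+1%:R / 2 ^+ n + (d < pi n)%:R :> R.
  by move: ih step; lra.
(* Multiplying by [2 ^+ n.+1] leaves an inequality between natural numbers. *)
rewrite exprS invfM mulrA -mulrDl -ler_pdivlMr ?invr_gt0// invrK mulrDl.
rewrite divfK ?gt_eqF// -(@ler_pM2l R 2)// mulrDr mulrCA divff ?pnatr_eq0// mulr1.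
rewrite -natrX -!natrM -!natrD -natrM ler_nat.
by rewrite /r ltnNge; have := pi_le n; case: ifP; case: (X n) => /=; lia.
Qed.

Lemma sum_mem_seq_le (s : seq nat) n :
  (\sum_(0 <= k < n) (k \in s) <= size s)%N.
Proof.
rewrite -(big_mkcond (fun k => k \in s) (fun=> 1%N)) sum1_count -size_filter.
apply: uniq_leq_size; first by rewrite filter_uniq ?iota_uniq.
by move=> k; rewrite mem_filter => /andP[].
Qed.

(** If [X] were guessed only at the lengths in a finite list, the total length
    of the arcs would be bounded by one more than the size of that list. *)
Lemma guessed_reals_arc_family (R : realType) (pi : nat -> nat) :
  (forall n, (pi n <= 2 ^ n)%N) ->
  (\sum_(0 <= n <oo) ((pi n)%:R / 2 ^+ n : R)%:E = +oo)%E ->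
  guessed_reals (arc_family pi) = setT.
Proof.
move=> pi_le pi_div; apply/seteqP; split => // X _ /= /finite_seqP[s sE].
have hit k : (arc_rank pi X k < pi k)%N = (k \in s).
  rewrite -mem_arc_family; apply/idP/idP => [kA|ks].
    by have : [set` s] k by rewrite -sE.
  by have : [set` s] k by []; rewrite -sE.
suff : (\sum_(0 <= n <oo) ((pi n)%:R / 2 ^+ n : R)%:E <= (1 + (size s)%:R)%:E)%E.
  by rewrite pi_div leye_eq.
apply: lime_le.
  apply: is_cvg_nneseries => n _ _.
  by rewrite lee_fin divr_ge0 ?exprn_ge0.
apply: nearW => n; rewrite sumEFin lee_fin.
have := arc_length_le_hits R pi X n pi_le.
under [X in (_ <= _ + X%:R) -> _]eq_bigr do rewrite hit.
have : 0 <= (arc_rank pi X n).+1%:R / 2 ^+ n :> R by rewrite divr_ge0 ?exprn_ge0.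
have := sum_mem_seq_le s n; rewrite -(ler_nat R).
lra.
Qed.

Theorem theorem3p2 (R : realType) (pi : nat -> nat)
  (pi_le : forall n, (pi n <= 2 ^ n)%N)
  (pi_div : (\sum_(0 <= n <oo) ((pi n)%:R / 2 ^+ n : R)%:E = +oo)%E) :
  exists A : forall n, {set {set 'I_n}},
    (forall n, #|A n| = pi n) /\
    fair_coin R (guessed_reals A) = 1%E.
Proof.
exists (arc_family pi); split => [n|]; first exact: card_arc_family.
by rewrite (guessed_reals_arc_family R pi pi_le pi_div) probability_setT.
Qed.
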